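(* Consider the UAV-assisted backscatter system with $M$ tags described in the context, where all channels are Nakagami-$m$ fading with the LoS/NLoS mixture described there. Then the system average outage probability $P_{\mathrm{in}}=\frac1M\sum_{m=1}^M P_{\mathrm{in},m}$ is given by $$P_{\mathrm{in}} = 1-\frac1M\sum_{m=1}^M A\cdot B_m\cdot C_m,$$ where $$A = 1-p_{VB,L}\,\Gamma\!\left(k_{VB,L},\frac{\gamma_{\mathrm{th}}^{U}\sigma_B^2 d_{VB}^2\,k_{VB,L}}{P_V\beta_0}\right)-p_{VB,N}\,\Gamma\!\left(k_{VB,N},\frac{\gamma_{\mathrm{th}}^{U}\sigma_B^2 d_{VB}^2\,k_{VB,N}}{P_V\eta_{VB}\beta_0}\right),$$ $$B_m = 1-p_{VU_m,L}\,\Gamma\!\left(k_{VU_m,L},\frac{P_C\, d_{VU_m}^2\,k_{VU_m,L}}{(m-\eta_R)\eta_C P_V\beta_0}\right)-p_{VU_m,N}\,\Gamma\!\left(k_{VU_m,N},\frac{P_C\, d_{VU_m}^2\,k_{VU_m,N}}{(m-\eta_R)\eta_C P_V\beta_0\,\eta_{VU_m}}\right),$$ $$C_m = 1-\int_0^\infty\Bigg[p_{VU_m,L}\,\Gamma\!\left(k_{VU_m,L},\frac{\gamma_{\mathrm{th}}^{m}(y\sigma_{U_m}^2+\sigma_V^2)\,d_{VU_m}^2\,k_{VU_m,L}}{\eta_R P_V\, y\,\beta_0}\right)+p_{VU_m,N}\,\Gamma\!\left(k_{VU_m,N},\frac{\gamma_{\mathrm{th}}^{m}(y\sigma_{U_m}^2+\sigma_V^2)\,d_{VU_m}^2\,k_{VU_m,N}}{\eta_R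 P_V\, y\,\eta_{VU_m}\beta_0}\right)\Bigg]\Big(p_{VU_m,L}\,f_{VU_m,L}(y)+p_{VU_m,N}\,f_{VU_m,N}(y)\Big)\,dy.$$
   Context: Notation: $\Gamma(x)$ is the Gamma function, and the two-argument $\Gamma(s,x)=\frac{1}{\Gamma(s)}\int_0^x t^{s-1}e^{-t}\,dt$ is the regularized lower incomplete gamma function. The subscripts $L$ and $N$ stand for LoS (line of sight) and NLoS (non line of sight). Geometry: $M\ge1$ is an integer. Tag $U_m$ ($1\le m\le M$) is at the given position $(x_{U_m},0)$, the base station (BS) is at $(x_B,0)$. The UAV collects data at $(x_1,h)$ and uploads at $(x_2,h)$, with $h>0$. Put $d_{VU_m}=\sqrt{h^2+(x_1-x_{U_m})^2}$, $d_{VB}=\sqrt{h^2+(x_2-x_B)^2}$, and, for $a\in\{VB,VU_1,\dots,VU_M\}$, the elevation angle $\theta_a=\frac{180}{\pi}\arcsin(h/d_a)$ (in degrees). LoS probability: for positive constants $c,q$, $p_{a,L}=\frac{1}{1+c\exp[-q(\theta_a-c)]}$ and $p_{a,N}=1-p_{a,L}$. Channels: for shape factors $k_{a,L},k_{a,N}>0$, $\beta_0>0$ and $\eta_a>0$, put $\Omega_{a,L}=\beta_0 d_a^{-2}$, $\Omega_{a,N}=\eta_a\beta_0 d_a^{-2}$ and, for $b\in\{L,N\}$, define the Gamma density $$f_{a,b}(x)=\frac{1}{\Gamma(k_{a,b})}\left(\frac{k_{a,b}}{\Omega_{a,b}}\right)^{k_{a,b}}x^{k_{a,b}-1}e^{-k_{a,b}x/\Omega_{a,b}},\quad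 x>0 .$$ The power gain $|g_a|^2$ has the mixture density $p_{a,L}f_{a,L}+p_{a,N}f_{a,N}$. For each $m$, $g'_{VU_m}$ is a second channel between the UAV and $U_m$, with $|g'_{VU_m}|^2$ having the same distribution as $|g_{VU_m}|^2$; the random variables $|g_{VU_m}|^2$, $|g'_{VU_m}|^2$, $|g_{VB}|^2$ are independent. Signals: $P_V>0$ is the UAV transmit power, $\eta_R\in(0,1)$ the fraction of reflected power, $\eta_C>0$ the circuit conversion efficiency, $P_C>0$ the tag circuit power loss, $T_B>0$ the backscatter duration (divided into $M$ equal slots), $T_U>0$ the upload duration, and $\sigma_{U_m}^2,\sigma_V^2,\sigma_B^2>0$ noise powers. The SNRs are $$\gamma_{U_mV}=\frac{\eta_R P_V|g_{VU_m}|^2|g'_{VU_m}|^2}{|g_{VU_m}|^2\sigma_{U_m}^2+\sigma_V^2},\qquad \gamma_{VB}=\frac{P_V|g_{VB}|^2}{\sigma_B^2}.$$ With tag rates $R_m>0$ and upload rate $R_U$ determined by $T_UR_U=\sum_{m=1}^M\frac{T_B}{M}R_m$, the thresholds are $\gamma_{\mathrm{th}}^m=2^{R_m}-1$ and $\gamma_{\mathrm{th}}^U=2^{R_U}-1$. Outage probabilities: the energy received by tag $m$ is $\varepsilon_m=\frac{(m-\eta_R)\eta_C P_V|g_{VU_m}|^2T_B}{M}$, and its energy outage probability is $P_{E,m}=\Pr\left(\varepsilon_m<\frac{T_B}{M}P_C\right)$. The outage probability between tag $m$ and the BS is defined to be $$P_{\mathrm{in},m}=\left[1-\Pr(\gamma_{U_mV}\ge\gamma_{\mathrm{th}}^m,\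 \gamma_{VB}\ge\gamma_{\mathrm{th}}^U)\right](1-P_{E,m})+P_{E,m}.$$ *)

(* Defs.v *)
From HB Require Import structures.
From mathcomp Require Import all_boot all_order all_algebra.
From mathcomp Require Import all_classical all_reals all_analysis.

Set Implicit Arguments.
Unset Strict Implicit.
Unset Printing Implicit Defensive.

Import Order.TTheory GRing.Theory Num.Theory.
Import numFieldNormedType.Exports.

Local Open Scope classical_set_scope.
Local Open Scope ring_scope.

Definition Gamma {R : realType} (s : R) : R :=
  \int[lebesgue_measure]_(t in `]0, +oo[) (t `^ (s - 1) * expR (- t)).

(* Regularized: the two-argument [Gamma(s, x)] of the closed forms. *)
Definition lower_Gamma {R : realType} (s x : R) : R :=
  (Gamma s)^-1 *
  \int[lebesgue_measure]_(t in `]0, x[) (t `^ (s - 1) * expR (- t)).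

(* Gamma density of shape [k] and mean [Omega], extended by 0 to x <= 0. *)
Definition gamma_pdf {R : realType} (k Omega : R) : R -> R :=
  (fun x => (Gamma k)^-1 * (k / Omega) `^ k * x `^ (k - 1)
            * expR (- (k * x / Omega))) \_ `]0, +oo[.

Definition has_density {R : realType} {d : measure_display}
    {T : measurableType d} (P : probability T R) (X : {RV P >-> R})
    (f : R -> R) : Prop :=
  forall A : set R, measurable A ->
    distribution P X A = (\int[lebesgue_measure]_(x in A) (f x)%:E)%E.

Definition same_distribution {R : realType} {d : measure_display}
    {T : measurableType d} (P : probability T R) (X Y : {RV P >-> R}) : Prop :=
  forall A : set R, measurable A -> distribution P X A = distribution P Y A.

(* The product rule for pairs is the case where one of the sets is [setT]. *)
Definition independent3 {R : realType} {d : measure_display}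
    {T : measurableType d} (P : probability T R) (X Y Z : {RV P >-> R}) : Prop :=
  forall A B C : set R, measurable A -> measurable B -> measurable C ->
    P (X @^-1` A `&` Y @^-1` B `&` Z @^-1` C) =
    (P (X @^-1` A) * P (Y @^-1` B) * P (Z @^-1` C))%E.

Inductive sight := LoS | NLoS.

(* Links of a system with M tags: UAV to base station, UAV to tag m. *)
Inductive link (M : nat) := VB | VU of 'I_M.
Arguments VB {M}.

(* Tags are indexed from 0: [m : 'I_M] is tag U_{m+1}.
   The [noise] fields are noise powers, i.e. the squares sigma^2. *)
Record system (R : realType) (M : nat) := System {
  tag_pos : 'I_M -> R;
  bs_pos : R;
  collect_pos : R;
  upload_pos : R;
  height : R;
  los_c : R;
  los_q : R;
  shape_factor : link M -> sight -> R;
  beta0 : R;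
  eta_nlos : link M -> R;
  PV : R;
  etaR : R;
  etaC : R;
  PC : R;
  TB : R;
  TU : R;
  noiseU : 'I_M -> R;
  noiseV : R;
  noiseB : R;
  rate : 'I_M -> R;
  rateU : R;
  height_gt0 : 0 < height;
  los_c_gt0 : 0 < los_c;
  los_q_gt0 : 0 < los_q;
  shape_gt0 : forall a b, 0 < shape_factor a b;
  beta0_gt0 : 0 < beta0;
  eta_nlos_gt0 : forall a, 0 < eta_nlos a;
  PV_gt0 : 0 < PV;
  etaR_gt0 : 0 < etaR;
  etaR_lt1 : etaR < 1;
  etaC_gt0 : 0 < etaC;
  PC_gt0 : 0 < PC;
  TB_gt0 : 0 < TB;
  TU_gt0 : 0 < TU;
  noiseU_gt0 : forall m, 0 < noiseU m;
  noiseV_gt0 : 0 < noiseV;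
  noiseB_gt0 : 0 < noiseB;
  rate_gt0 : forall m, 0 < rate m;
  rateUE : TU * rateU = \sum_(m < M) TB / M%:R * rate m
}.

Definition dist {R : realType} {M : nat} (s : system R M) (a : link M) : R :=
  match a with
  | VB => Num.sqrt (height s ^+ 2 + (upload_pos s - bs_pos s) ^+ 2)
  | VU m => Num.sqrt (height s ^+ 2 + (collect_pos s - tag_pos s m) ^+ 2)
  end.

(* In degrees. *)
Definition elevation {R : realType} {M : nat} (s : system R M) (a : link M) : R :=
  180 / pi * asin (height s / dist s a).

Definition los_prob {R : realType} {M : nat} (s : system R M) (a : link M) : R :=
  1 / (1 + los_c s * expR (- los_q s * (elevation s a - los_c s))).

Definition prob {R : realType} {M : nat} (s : system R M) (a : link M)
    (b : sight) : R :=
  match b with LoS => los_prob s a | NLoS => 1 - los_prob s a end.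

Definition Omega {R : realType} {M : nat} (s : system R M) (a : link M)
    (b : sight) : R :=
  match b with
  | LoS => beta0 s * dist s a ^- 2
  | NLoS => eta_nlos s a * beta0 s * dist s a ^- 2
  end.

Definition link_pdf {R : realType} {M : nat} (s : system R M) (a : link M)
    (b : sight) : R -> R :=
  gamma_pdf (shape_factor s a b) (Omega s a b).

Definition gain_pdf {R : realType} {M : nat} (s : system R M) (a : link M)
    (x : R) : R :=
  prob s a LoS * link_pdf s a LoS x + prob s a NLoS * link_pdf s a NLoS x.

Definition threshold {R : realType} {M : nat} (s : system R M) (m : 'I_M) : R :=
  2 `^ rate s m - 1.

Definition thresholdU {R : realType} {M : nat} (s : system R M) : R :=
  2 `^ rateU s - 1.

(* In the next definitions the arguments g, g' are values of the power gains
   |g|^2, |g'|^2, not of the channel coefficients. *)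
Definition snr_tag {R : realType} {M : nat} (s : system R M) (m : 'I_M)
    (g g' : R) : R :=
  etaR s * PV s * g * g' / (g * noiseU s m + noiseV s).

Definition snr_bs {R : realType} {M : nat} (s : system R M) (g : R) : R :=
  PV s * g / noiseB s.

(* The factor m - eta_R uses the 1-based index of the tag. *)
Definition energy {R : realType} {M : nat} (s : system R M) (m : 'I_M)
    (g : R) : R :=
  (m.+1%:R - etaR s) * etaC s * PV s * g * TB s / M%:R.

Definition energy_outage {R : realType} {d : measure_display}
    {T : measurableType d} {P : probability T R} {M : nat} (s : system R M)
    (gVU : 'I_M -> {RV P >-> R}) (m : 'I_M) : R :=
  fine (P [set w | energy s m (gVU m w) < TB s / M%:R * PC s]).

Definition tag_outage {R : realType} {d : measure_display}
    {T : measurableType d} {P : probability T R} {M : nat} (s : system R M)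
    (gVU gVU' : 'I_M -> {RV P >-> R}) (gVB : {RV P >-> R}) (m : 'I_M) : R :=
  (1 - fine (P [set w | threshold s m <= snr_tag s m (gVU m w) (gVU' m w) /\
                        thresholdU s <= snr_bs s (gVB w)]))
    * (1 - energy_outage s gVU m)
  + energy_outage s gVU m.

Definition system_outage {R : realType} {d : measure_display}
    {T : measurableType d} {P : probability T R} {M : nat} (s : system R M)
    (gVU gVU' : 'I_M -> {RV P >-> R}) (gVB : {RV P >-> R}) : R :=
  M%:R^-1 * \sum_(m < M) tag_outage s gVU gVU' gVB m.

(* Main.v *)
Require Import Defs.
From HB Require Import structures.
From mathcomp Require Import all_boot all_order all_algebra.
From mathcomp Require Import all_classical all_reals all_analysis.
From mathcomp Require Import measurable_realfun ring.

Set Implicit Arguments.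
Unset Strict Implicit.
Unset Printing Implicit Defensive.

Import Order.TTheory GRing.Theory Num.Theory.
Import numFieldNormedType.Exports.

Local Open Scope classical_set_scope.
Local Open Scope ring_scope.

(* The outage probability of a tag is 1 - P(decode) (1 - P_E). Independence
   factors P(decode) into the upload factor A and the probability that the
   tag-UAV SNR is large enough; given the value y > 0 of the first gain, the
   latter event is a lower bound on the second gain, and integrating over y
   gives C_m. Each remaining probability is a value of the distribution
   function of a mixture of Gamma laws, which the substitution t = k x / Omega
   turns into incomplete Gamma functions. *)

(** * Linear change of variables for the Lebesgue integral *)

(** By uniqueness of the Lebesgue measure: [a] times the pushforward along multiplication by [a]
    gives each half-open interval its length. *)
Lemma lebesgue_measureZ {R : realType} (a : R) (A : set R) :
    0 < a -> measurable A ->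
  lebesgue_measure A = (a%:E * lebesgue_measure ( *%R a @^-1` A))%E.
Proof.
move=> a_gt0 mA.
have ma : measurable_fun [set: measurableTypeR R]
  ( *%R a : _ -> measurableTypeR R) by exact: measurable_funM.
pose nu : {measure set (measurableTypeR R) -> \bar R} :=
  mscale (NngNum (ltW a_gt0))
  (measure_function_pushforward__canonical__measure_function_Measure
    (@lebesgue_measure R) ma).
apply: (@lebesgue_measure_unique _ nu) => //= _ [[x y]] _ <-.
rewrite /nu /mscale/= /pushforward.
rewrite (_ : _ @^-1` _ = `]x / a, y / a]%classic); last first.
  by apply/seteqP; split=> t /=;
    rewrite !in_itv/= ltr_pdivrMr// ler_pdivlMr// ![t * _]mulrC.
rewrite !lebesgue_measure_itv/= !lte_fin ltr_pM2r ?invr_gt0//.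
case: ifP => _; last by rewrite mule0.
by rewrite -!EFinD -EFinM -mulrBl mulrCA divff ?gt_eqF// mulr1.
Qed.

(* Proved on the level of measures because the Gamma integrand is unbounded
   near 0 for shapes below 1, which rules out the substitution lemmas of ftc,
   where the integrand has to be continuous up to the endpoints. *)
Lemma ge0_integralZ_lebesgue {R : realType} (a : R) (D : set R) (f : R -> R) :
    0 < a -> measurable D -> measurable_fun D f ->
    (forall x, D x -> 0 <= f x) ->
  (\int[lebesgue_measure]_(x in D) (f x)%:E =
   \int[lebesgue_measure]_(x in *%R a @^-1` D) (a * f (a * x))%:E)%E.
Proof.
move=> a_gt0 mD mf f_ge0.
have ma : measurable_fun [set: measurableTypeR R]
  ( *%R a : _ -> measurableTypeR R) by exact: measurable_funM.
have maD : measurable ( *%R a @^-1` D).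
  by rewrite -[X in measurable X]setTI; exact: ma.
pose nu := measure_function_pushforward__canonical__measure_function_Measure
    (@lebesgue_measure R) ma.
transitivity (\int[mscale (NngNum (ltW a_gt0)) nu]_(x in D) (f x)%:E)%E.
  by apply: eq_measure_integral => A mA _; exact: lebesgue_measureZ.
rewrite ge0_integral_mscale//; last exact/measurable_EFinP.
rewrite [in LHS]ge0_integral_pushforward//=; [|exact/measurable_EFinP|].
- under [RHS]eq_integral do rewrite EFinM.
  rewrite ge0_integralZl_EFin//=; last exact: ltW.
    by move=> x; exact: f_ge0.
  apply/measurable_EFinP.
  apply: (measurable_comp mD _ mf) => //.
  by move=> _ [x Dx <-].
- by move=> x; rewrite inE => Dx; exact: f_ge0.
Qed.

(** * Gamma densities and incomplete Gamma functions *)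

Lemma measurable_Gamma_integrand {R : realType} (s : R) (D : set R) :
  measurable_fun D (fun t : R => t `^ (s - 1) * expR (- t)).
Proof.
apply: measurable_funTS; apply: measurable_funM => //.
by apply: measurableT_comp => //; exact: measurable_funN.
Qed.

Lemma Gamma_integrand_ge0 {R : realType} (s t : R) :
  0 <= t `^ (s - 1) * expR (- t).
Proof. by rewrite mulr_ge0 ?powR_ge0 ?expR_ge0. Qed.

Lemma Gamma_ge0 {R : realType} (s : R) : 0 <= Gamma s.
Proof. by apply: Rintegral_ge0 => t _; exact: Gamma_integrand_ge0. Qed.

(* If the Gamma integral diverged then [Gamma s], hence [(Gamma s)^-1], would
   be the junk value 0, and the identity would still hold. *)
Lemma EFin_lower_Gamma {R : realType} (s x : R) :
  (lower_Gamma s x)%:E = ((Gamma s)^-1%:E *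
    \int[lebesgue_measure]_(t in `]0%R, x[) (t `^ (s - 1) * expR (- t))%:E)%E.
Proof.
rewrite /lower_Gamma EFinM; have [->|Gs0] := eqVneq (Gamma s) 0.
  by rewrite invr0 !mul0e.
congr (_ * _)%E; rewrite fineK// ge0_fin_numE; last first.
  by apply: integral_ge0 => t _; rewrite lee_fin Gamma_integrand_ge0.
apply: (@le_lt_trans _ _ (\int[lebesgue_measure]_(t in `]0%R, +oo[)
    (t `^ (s - 1) * expR (- t))%:E)%E).
  apply: ge0_subset_integral => //=.
  - by apply/measurable_EFinP; exact: measurable_Gamma_integrand.
  - by move=> t _; rewrite lee_fin Gamma_integrand_ge0.
  - by move=> t /=; rewrite !in_itv/= andbT => /andP[].
rewrite ltNge leye_eq; apply: contra Gs0 => /eqP Goo.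
by rewrite /Gamma /Rintegral Goo.
Qed.

Lemma gamma_pdf_ge0 {R : realType} (k Omega x : R) :
  0 <= gamma_pdf k Omega x.
Proof.
rewrite /gamma_pdf patchE; case: ifP => // _.
by rewrite !mulr_ge0 ?powR_ge0 ?expR_ge0// invr_ge0 Gamma_ge0.
Qed.

Lemma gamma_pdf_le0 {R : realType} (k Omega x : R) :
  x <= 0 -> gamma_pdf k Omega x = 0.
Proof.
by move=> x0; rewrite /gamma_pdf patchE memNset//= in_itv/= andbT ltNge x0.
Qed.

Lemma measurable_gamma_pdf {R : realType} (k Omega : R) :
  measurable_fun [set: R] (gamma_pdf k Omega).
Proof.
apply/(measurable_restrictT _ _).1 => //; apply: measurable_funTS.
apply: measurable_funM; first exact: measurable_funM.
apply: measurableT_comp => //; apply: measurable_funN.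
by apply: measurable_funM => //; exact: measurable_funM.
Qed.

(** The substitution t = (k / Omega) y turns the Gamma integrand into the density. For x <= 0 both
    sides are 0. *)
Lemma integral_gamma_pdf {R : realType} (k Omega x : R) :
    0 < k -> 0 < Omega ->
  (\int[lebesgue_measure]_(y in `]-oo, x[) (gamma_pdf k Omega y)%:E)%E =
  (lower_Gamma k (k * x / Omega))%:E.
Proof.
move=> k_gt0 O_gt0; have a_gt0 : 0 < k / Omega by rewrite divr_gt0.
rewrite EFin_lower_Gamma mulrAC [in RHS](ge0_integralZ_lebesgue a_gt0)//;
  last 2 first.
- exact: measurable_Gamma_integrand.
- by move=> t _; exact: Gamma_integrand_ge0.
rewrite (_ : _ @^-1` _ = `]0, x[%classic); last first.
  by apply/seteqP; split=> t /=; rewrite !in_itv/= pmulr_rgt0// ltr_pM2l.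
rewrite -ge0_integralZl_EFin//; last 3 first.
- by move=> t _; rewrite lee_fin mulr_ge0 ?(ltW a_gt0)// Gamma_integrand_ge0.
- apply/measurable_EFinP; apply: measurable_funM => //.
  apply: (measurable_comp measurableT _
    (@measurable_Gamma_integrand R k setT)) => //.
- by rewrite invr_ge0 Gamma_ge0.
(* The domains []-oo, x[] and []0, x[] differ only where the density is 0, so the extensions by zero
   agree pointwise. *)
rewrite [LHS]integral_mkcond [RHS]integral_mkcond; apply: eq_integral => y _.
rewrite !patchE /gamma_pdf patchE.
have [y_gt0|y_le0] := ltP 0 y; last first.
  rewrite (_ : y \in `]0, +oo[%classic = false); last first.
    by apply/memNset; rewrite /= in_itv/= ltNge y_le0.
  rewrite (_ : y \in `]0, x[%classic = false); last first.
    by apply/memNset; rewrite /= in_itv/= ltNge y_le0.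
  by case: ifP.
rewrite (_ : (y \in `]0, +oo[%classic)); last by rewrite inE/= in_itv/= y_gt0.
rewrite (_ : (y \in `]-oo, x[%classic) = (y \in `]0, x[%classic)); last first.
  by apply/idP/idP; rewrite !inE/= !in_itv/= y_gt0.
case: ifP => // _; rewrite -EFinM; congr EFin.
(* One factor of (k / Omega)^k is the Jacobian; the other k - 1 are absorbed in (k y / Omega)^(k -
   1). *)
rewrite -(mulr_powRB1 (ltW a_gt0) k_gt0) (powRM _ (ltW a_gt0) (ltW y_gt0)).
rewrite (_ : k / Omega * y = k * y / Omega); last by rewrite mulrAC.
ring.
Qed.

(** * Law of a single power gain *)

Lemma ge0_integral_lin2 {d : measure_display} {T : measurableType d}
    {R : realType} (mu : {measure set T -> \bar R}) (D : set T) (p q : R)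
    (f g : T -> R) : measurable D -> 0 <= p -> 0 <= q ->
    measurable_fun D f -> measurable_fun D g ->
    (forall x, D x -> 0 <= f x) -> (forall x, D x -> 0 <= g x) ->
  (\int[mu]_(x in D) (p * f x + q * g x)%:E =
   p%:E * \int[mu]_(x in D) (f x)%:E + q%:E * \int[mu]_(x in D) (g x)%:E)%E.
Proof.
move=> mD p0 q0 mf mg f0 g0; under eq_integral do rewrite EFinD.
rewrite ge0_integralD//.
- under eq_integral do rewrite EFinM.
  under [X in (_ + X)%E]eq_integral do rewrite EFinM.
  by rewrite !ge0_integralZl_EFin//; exact/measurable_EFinP.
- by move=> x Dx; rewrite lee_fin mulr_ge0// f0.
- by apply/measurable_EFinP; exact: measurable_funM.
- by move=> x Dx; rewrite lee_fin mulr_ge0// g0.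
- by apply/measurable_EFinP; exact: measurable_funM.
Qed.

(** Distribution function of the LoS/NLoS mixture, with the substitution already carried out. *)
Definition gain_cdf {R : realType} {M : nat} (s : system R M) (a : link M)
    (x : R) : R :=
  prob s a LoS * lower_Gamma (shape_factor s a LoS)
                   (shape_factor s a LoS * x / Omega s a LoS) +
  prob s a NLoS * lower_Gamma (shape_factor s a NLoS)
                   (shape_factor s a NLoS * x / Omega s a NLoS).

Lemma dist_gt0 {R : realType} {M : nat} (s : system R M) (a : link M) :
  0 < dist s a.
Proof.
by case: a => [|m] /=;
  rewrite sqrtr_gt0 ltr_wpDr ?sqr_ge0// exprn_gt0// height_gt0.
Qed.

Lemma Omega_gt0 {R : realType} {M : nat} (s : system R M) (a : link M)
    (b : sight) : 0 < Omega s a b.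
Proof.
by case: b => /=; rewrite !mulr_gt0 ?beta0_gt0 ?eta_nlos_gt0//
  invr_gt0 exprn_gt0// dist_gt0.
Qed.

Lemma prob_ge0 {R : realType} {M : nat} (s : system R M) (a : link M)
    (b : sight) : 0 <= prob s a b.
Proof.
have D0 : 0 <= los_c s * expR (- los_q s * (elevation s a - los_c s)).
  by rewrite mulr_ge0 ?expR_ge0// ltW// los_c_gt0.
have D1 : 0 < 1 + los_c s * expR (- los_q s * (elevation s a - los_c s)).
  by rewrite ltr_wpDr.
case: b => /=; rewrite /los_prob; first by rewrite divr_ge0// ltW.
by rewrite subr_ge0 ler_pdivrMr// mul1r lerDl.
Qed.

Lemma gain_pdf_ge0 {R : realType} {M : nat} (s : system R M) (a : link M)
    (x : R) : 0 <= gain_pdf s a x.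
Proof. by rewrite addr_ge0// mulr_ge0 ?prob_ge0 ?gamma_pdf_ge0. Qed.

Lemma gain_pdf_le0 {R : realType} {M : nat} (s : system R M) (a : link M)
    (x : R) : x <= 0 -> gain_pdf s a x = 0.
Proof.
by move=> x0; rewrite /gain_pdf /link_pdf !gamma_pdf_le0// !mulr0 addr0.
Qed.

Lemma measurable_gain_pdf {R : realType} {M : nat} (s : system R M)
    (a : link M) : measurable_fun [set: R] (gain_pdf s a).
Proof.
by apply: measurable_funD; apply: measurable_funM => //;
  exact: measurable_gamma_pdf.
Qed.

Lemma integral_gain_pdf {R : realType} {M : nat} (s : system R M) (a : link M)
    (x : R) :
  (\int[lebesgue_measure]_(y in `]-oo, x[) (gain_pdf s a y)%:E)%E =
  (gain_cdf s a x)%:E.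
Proof.
rewrite ge0_integral_lin2 ?prob_ge0//.
- by rewrite !integral_gamma_pdf ?Omega_gt0 ?shape_gt0// -!EFinM -EFinD.
- by apply: measurable_funTS; exact: measurable_gamma_pdf.
- by apply: measurable_funTS; exact: measurable_gamma_pdf.
- by move=> y _; exact: gamma_pdf_ge0.
- by move=> y _; exact: gamma_pdf_ge0.
Qed.

Section gain_law.
Context {R : realType} {d : measure_display} {T : measurableType d}
  {P : probability T R} {M : nat} {s : system R M} {a : link M}
  {X : {RV P >-> R}}.
Hypothesis X_density : has_density X (gain_pdf s a).

Lemma probability_gain_lt (x : R) :
  P [set w | X w < x] = (gain_cdf s a x)%:E.
Proof.
by rewrite -integral_gain_pdf -X_density.
Qed.

(** The strict inequality in [probability_gain_lt] makes this event an exact complement, so atoms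
    need no discussion. *)
Lemma probability_gain_ge (x : R) :
  P [set w | x <= X w] = (1 - gain_cdf s a x)%:E.
Proof.
have mX : measurable [set w | X w < x].
  rewrite (_ : mkset _ = X @^-1` `]-oo, x[%classic).
    by rewrite -[X in measurable X]setTI; exact: measurable_funP.
  by apply/seteqP; split=> w; rewrite /= in_itv.
rewrite (_ : mkset _ = ~` [set w | X w < x]).
  by rewrite probability_setC// probability_gain_lt.
by apply/seteqP; split=> w /=; rewrite leNgt => /negP.
Qed.

End gain_law.

(** * Integration against densities, and independence *)

(** [has_density] speaks of sets only. It makes the law of [X] dominated by the Lebesgue measure,
    and [f] has the same integrals over measurable sets as the Radon-Nikodym derivative, hence
    equals it almost everywhere. *)
Lemma ge0_integral_has_density {R : realType} {d : measure_display}
    {T : measurableType d} {P : probability T R} (X : {RV P >-> R})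
    (f : R -> R) (g : R -> \bar R) :
    has_density X f -> measurable_fun setT f ->
    measurable_fun setT g -> (forall x, 0 <= g x)%E ->
  (\int[P]_w g (X w) =
   \int[lebesgue_measure]_x (g x * (f x)%:E))%E.
Proof.
move=> Xf mf mg g0.
(* [lebesgue_measure] lives on [measurableTypeR R], which has the same Borel
   sets as [R] but another display, so the law of [X] is transported there. *)
have mX : measurable_fun setT (X : T -> measurableTypeR R).
  exact: (measurable_funP X).
pose X' : {mfun T >-> measurableTypeR R} :=
  HB.pack (X : T -> measurableTypeR R) (isMeasurableFun.Build _ _ _ _ _ mX).
pose nu : {finite_measure set (measurableTypeR R) -> \bar R} :=
  distribution P X'.
have dom : nu `<< (@lebesgue_measure R).
  apply/null_content_dominatesP => A mA A0; rewrite [LHS]Xf//.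
  apply: null_set_integral => //; exact/measurable_EFinP/measurable_funTS.
rewrite -[LHS](@ge0_integral_distribution _ _ _ _ _ P X')//.
rewrite -[LHS](Radon_Nikodym_SigmaFinite.change_of_variables dom)//.
apply: ae_eq_integral => //.
- apply: emeasurable_funM => //.
  exact: measurable_int (Radon_Nikodym_SigmaFinite.f_integrable dom).
- by apply: emeasurable_funM => //; exact/measurable_EFinP.
- apply: ae_eqe_mul2l; apply: integral_ae_eq => //.
  + exact: Radon_Nikodym_SigmaFinite.f_integrable.
  + exact/measurable_EFinP.
  + move=> A _ mA; rewrite -Radon_Nikodym_SigmaFinite.f_integral//.
    exact: Xf.
Qed.

(** Agreement on rectangles determines a product of sigma-finite measures. A general [mu] allows for
    a probability restricted to an event. *)
Lemma product_law_unique {R : realType} {d d1 d2 : measure_display}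
    {T : measurableType d} {T1 : measurableType d1} {T2 : measurableType d2}
    (mu : {measure set T -> \bar R})
    (m1 : {sigma_finite_measure set T1 -> \bar R})
    (m2 : {sigma_finite_measure set T2 -> \bar R})
    (X : {mfun T >-> T1}) (Y : {mfun T >-> T2}) (A : set (T1 * T2)) :
    (forall B C, measurable B -> measurable C ->
      mu (X @^-1` B `&` Y @^-1` C) = m1 B * m2 C)%E ->
    measurable A ->
  mu [set w | A (X w, Y w)] = (m1 \x m2)%E A.
Proof.
move=> XY mA.
have mXY : measurable_fun setT (fun w => (X w, Y w)).
  exact: measurable_fun_pair.
exact/esym/(product_measure_unique (m' :=
  measure_function_pushforward__canonical__measure_function_Measure mu mXY)).
Qed.

(** Lets a weighted law be a factor of a product measure, which asks for sigma-finiteness. *)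
Lemma mscale_finite {d : measure_display} {T : measurableType d}
    {R : realType} (c : {nonneg R}) (mu : {finite_measure set T -> \bar R}) :
  fin_num_fun (mscale c mu).
Proof. by move=> A mA; rewrite /mscale fin_numM// fin_num_measure. Qed.

HB.instance Definition _ (d : measure_display) (T : measurableType d)
    (R : realType) (c : {nonneg R}) (mu : {finite_measure set T -> \bar R}) :=
  Measure_isFinite.Build _ _ _ (mscale c mu) (mscale_finite c mu).

(* Averaging over the value of [X], with the event on [Z] as a constant
   weight in the law of [X]. *)
Lemma independent3_section {R : realType} {d : measure_display}
    {T : measurableType d} {P : probability T R} (X Y Z : {RV P >-> R})
    (A : set (R * R)) (C : set R) :
    independent3 X Y Z -> measurable A -> measurable C ->
  P ([set w | A (X w, Y w)] `&` Z @^-1` C) =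
  (P (Z @^-1` C) * \int[distribution P X]_x P [set w | A (x, Y w)])%E.
Proof.
move=> XYZ mA mC.
have mZC : measurable (Z @^-1` C).
  by rewrite -[X in measurable X]setTI; exact: measurable_funP.
have PZ0 : 0 <= fine (P (Z @^-1` C)) by exact: fine_ge0.
pose c := NngNum PZ0.
have cE : ((fine (P (Z @^-1` C)))%:E = P (Z @^-1` C))%E.
  by rewrite fineK// fin_num_measure.
transitivity ((mscale c (distribution P X) \x distribution P Y)%E A).
  (* Restricting [P] to the event on [Z] turns the triple product rule into a rule for [X] and [Y],
     with P(Z in C) as the weight [c] on the law of [X]. *)
  rewrite -(product_law_unique (mu := mrestr P mZC) (X := X) (Y := Y))//.
  move=> B D mB mD; rewrite /= /mrestr XYZ//.
  by rewrite -cE muleC muleA.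
rewrite /product_measure1 ge0_integral_mscale//;
  last exact: measurable_fun_xsection.
rewrite /= cE; congr (_ * _)%E; apply: eq_integral => x _; congr (P _).
by apply/seteqP; split=> w /=; rewrite /xsection/= inE.
Qed.

Lemma measurable_section_probability {R : realType} {d : measure_display}
    {T : measurableType d} {P : probability T R} (Y : {RV P >-> R})
    (A : set (R * R)) : measurable A ->
  measurable_fun setT (fun x => P [set w | A (x, Y w)]).
Proof.
move=> mA.
rewrite (_ : (fun x => _) = distribution P Y \o xsection A).
  exact: measurable_fun_xsection.
apply/funext => x; congr (P _).
by apply/seteqP; split=> w /=; rewrite /xsection/= inE.
Qed.

Lemma independent3_density {R : realType} {d : measure_display}
    {T : measurableType d} {P : probability T R} (X Y Z : {RV P >-> R})
    (f : R -> R) (A : set (R * R)) (C : set R) :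
    independent3 X Y Z -> has_density X f -> measurable_fun setT f ->
    measurable A -> measurable C ->
  P ([set w | A (X w, Y w)] `&` Z @^-1` C) =
  (P (Z @^-1` C) *
   \int[lebesgue_measure]_x (P [set w | A (x, Y w)] * (f x)%:E))%E.
Proof.
move=> XYZ Xf mf mA mC; rewrite (independent3_section XYZ mA mC).
have mQ := measurable_section_probability Y mA.
rewrite ge0_integral_distribution//.
by congr (_ * _)%E; rewrite -(ge0_integral_has_density Xf mf mQ).
Qed.

(** * Averages over the gain density *)

Lemma integral_gain_pdf_total {R : realType} {M : nat} (s : system R M)
    (a : link M) (g : R -> \bar R) :
  (\int[lebesgue_measure]_x (g x * (gain_pdf s a x)%:E) =
   \int[lebesgue_measure]_(x in `]0%R, +oo[) (g x * (gain_pdf s a x)%:E))%E.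
Proof.
rewrite [RHS]integral_mkcond; apply: eq_integral => x _; rewrite patchE.
case: ifPn => //; rewrite notin_setE/= in_itv/= andbT => /negP.
by rewrite -leNgt => x0; rewrite gain_pdf_le0// mule0.
Qed.

(* On [x > 0], the only part of the line charged by the gain, [G x] plays the
   role of the conditional outage probability given that the gain is [x]. *)
Lemma integral_gain_pdf_compl {R : realType} {d : measure_display}
    {T : measurableType d} {P : probability T R} {M : nat} (s : system R M)
    (a : link M) (X : {RV P >-> R}) (G : R -> R) (Q : R -> \bar R) :
    has_density X (gain_pdf s a) ->
    (forall x, 0 < x -> Q x = (1 - G x)%:E) -> measurable_fun setT Q ->
    (forall x, 0 <= G x <= 1) ->
  (\int[lebesgue_measure]_x (Q x * (gain_pdf s a x)%:E))%E =
  (1 - \int[lebesgue_measure]_(x in `]0, +oo[) (G x * gain_pdf s a x))%:E.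
Proof.
move=> Xf QG mQ G01; pose D : set R := `]0, +oo[%classic.
have mD : measurable D by exact: measurable_itv.
have DP x : D x -> 0 < x by rewrite /D/= in_itv/= andbT.
have mf : measurable_fun D (gain_pdf s a).
  by apply: measurable_funTS; exact: measurable_gain_pdf.
(* Measurability of [G] is inherited from [Q], since [fine \o Q] is [1 - G] on [D]. *)
have mG : measurable_fun D (fun x => 1 - G x).
  apply: (eq_measurable_fun (fine \o Q)).
    by move=> x; rewrite inE => /DP x0/=; rewrite QG.
  by apply: measurable_funTS; exact: measurableT_comp.
have mG' : measurable_fun D G.
  rewrite (_ : G = fun x => 1 - (1 - G x)); first exact: measurable_funB.
  by apply/funext => x; rewrite subKr.
rewrite integral_gain_pdf_total.
transitivity (\int[lebesgue_measure]_(x in D)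
    ((1 - G x) * gain_pdf s a x)%:E)%E.
  by apply: eq_integral => x; rewrite inE => /DP x0; rewrite QG.
have G1f0 x : (0 <= ((1 - G x) * gain_pdf s a x)%:E)%E.
  rewrite lee_fin mulr_ge0 ?gain_pdf_ge0// subr_ge0.
  by have /andP[] := G01 x.
have Gf0 x : (0 <= (G x * gain_pdf s a x)%:E)%E.
  by rewrite lee_fin mulr_ge0 ?gain_pdf_ge0//; have /andP[] := G01 x.
(* The two integrands are nonnegative and add up to the density, of total mass 1; so both integrals
   are finite and one can be subtracted. *)
have total : (\int[lebesgue_measure]_(x in D) ((1 - G x) * gain_pdf s a x)%:E
    + \int[lebesgue_measure]_(x in D) (G x * gain_pdf s a x)%:E = 1)%E.
  rewrite -ge0_integralD//.
  - transitivity (\int[lebesgue_measure]_x (1 * (gain_pdf s a x)%:E))%E.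
      rewrite integral_gain_pdf_total; apply: eq_integral => x _.
      by rewrite -EFinD -mulrDl subrK.
    under eq_integral do rewrite mul1e.
    rewrite -Xf// /distribution/= /pushforward preimage_setT.
    exact: probability_setT.
  - by apply/measurable_EFinP; exact: measurable_funM.
  - by apply/measurable_EFinP; exact: measurable_funM.
have fin2 : (\int[lebesgue_measure]_(x in D) (G x * gain_pdf s a x)%:E)%E
    \is a fin_num.
  rewrite ge0_fin_numE; last by apply: integral_ge0 => x _; exact: Gf0.
  apply: (@le_lt_trans _ _ 1%E); last exact: ltry.
  by rewrite -total leeDr//; apply: integral_ge0 => x _; exact: G1f0.
by rewrite EFinB /Rintegral fineK// -total addeK.
Qed.

(** Reduces to measurability of real powers by x^-1 = x (x^2)^-1, true also at 0, where the inverse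
    is 0. The square provides the nonnegative base that [powR_inv1] requires. *)
Lemma measurable_invr {R : realType} :
  measurable_fun [set: R] (fun x : R => x^-1).
Proof.
rewrite (_ : (fun x => _) = fun x : R => x * (x * x) `^ (-1)).
  apply: measurable_funM => //.
  apply: (measurableT_comp (@measurable_powR R (-1))).
  exact: measurable_funM.
apply/funext => x; rewrite powR_inv1 -?expr2 ?sqr_ge0//.
by have [->|x0] := eqVneq x 0; [rewrite invr0 mul0r|field].
Qed.

(** The bounds are those of a probability: a variable with this density replaces a computation of
    the Gamma normalization. *)
Lemma gain_cdf_bound {R : realType} {d : measure_display}
    {T : measurableType d} {P : probability T R} {M : nat} (s : system R M)
    (a : link M) (X : {RV P >-> R}) (x : R) :
  has_density X (gain_pdf s a) -> 0 <= gain_cdf s a x <= 1.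
Proof.
move=> Xf; have Xx := probability_gain_lt Xf x.
rewrite -!lee_fin -Xx probability_le1 ?measure_ge0//.
rewrite (_ : mkset _ = X @^-1` `]-oo, x[%classic).
  by rewrite -[X in measurable X]setTI; exact: measurable_funP.
by apply/seteqP; split=> w; rewrite /= in_itv.
Qed.

Lemma gain_cdf_LoS_NLoS {R : realType} {M : nat} (s : system R M)
    (a : link M) (x : R) :
  gain_cdf s a x =
  prob s a LoS * lower_Gamma (shape_factor s a LoS)
    (x * dist s a ^+ 2 * shape_factor s a LoS / beta0 s) +
  prob s a NLoS * lower_Gamma (shape_factor s a NLoS)
    (x * dist s a ^+ 2 * shape_factor s a NLoS / (eta_nlos s a * beta0 s)).
Proof.
rewrite /gain_cdf /=; congr (_ * lower_Gamma _ _ + _ * lower_Gamma _ _).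
  by rewrite !invfM invrK; ring.
by rewrite !invfM invrK; ring.
Qed.

(** * Outage events as bounds on the gains *)

Section outage.
Context {R : realType} {d : measure_display} {T : measurableType d}
  {P : probability T R} {M : nat} (s : system R M).

Lemma measurable_snr_tag (m : 'I_M) :
  measurable [set p : R * R | threshold s m <= snr_tag s m p.1 p.2].
Proof.
rewrite -[X in measurable X]setTI; apply: measurable_fun_le => //.
apply: measurable_funM.
  by apply: measurable_funM => //; apply: measurable_funM.
apply: (measurableT_comp measurable_invr).
by apply: measurable_funD => //; apply: measurable_funM.
Qed.

(** Least second gain that reaches the SNR threshold when the first gain is [x]; meaningful for x >
    0 only. *)
Definition tag_cutoff (m : 'I_M) (x : R) : R :=
  threshold s m * (x * noiseU s m + noiseV s) / (etaR s * PV s * x).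

Lemma snr_tagE (m : 'I_M) (x y : R) : 0 < x ->
  (threshold s m <= snr_tag s m x y) = (tag_cutoff m x <= y).
Proof.
move=> x0; rewrite /snr_tag /tag_cutoff.
rewrite ler_pdivlMr; last by rewrite addr_gt0 ?mulr_gt0 ?noiseU_gt0 ?noiseV_gt0.
rewrite ler_pdivrMr; last by rewrite !mulr_gt0 ?etaR_gt0 ?PV_gt0.
by rewrite [y * _]mulrC.
Qed.

Lemma snr_bsE (g : R) :
  (thresholdU s <= snr_bs s g) = (thresholdU s * noiseB s / PV s <= g).
Proof.
by rewrite /snr_bs ler_pdivlMr ?noiseB_gt0// ler_pdivrMr ?PV_gt0// [g * _]mulrC.
Qed.

(** The 1-based index of a tag is at least 1, and [etaR s] is less than 1. *)
Lemma tag_gain_gt0 (m : 'I_M) : 0 < (m.+1%:R - etaR s) * etaC s * PV s.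
Proof.
rewrite !mulr_gt0 ?etaC_gt0 ?PV_gt0// subr_gt0 (lt_le_trans (etaR_lt1 s))//.
by rewrite ler1n.
Qed.

Lemma energyE (m : 'I_M) (g : R) :
  (energy s m g < TB s / M%:R * PC s) =
  (g < PC s / ((m.+1%:R - etaR s) * etaC s * PV s)).
Proof.
have M0 : 0 < M%:R :> R by rewrite ltr0n (leq_trans _ (ltn_ord m)).
have k0 : 0 < TB s / M%:R by rewrite divr_gt0 ?TB_gt0.
rewrite ltr_pdivlMr ?tag_gain_gt0// -[RHS](ltr_pM2l k0) /energy.
by congr (_ < _); ring.
Qed.

Variables (gVU gVU' : 'I_M -> {RV P >-> R}) (gVB : {RV P >-> R}).
Hypotheses (gVU_density : forall m, has_density (gVU m) (gain_pdf s (VU m)))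
  (gVB_density : has_density gVB (gain_pdf s VB))
  (gVU'_distr : forall m, same_distribution (gVU' m) (gVU m))
  (gVU_indep : forall m, independent3 (gVU m) (gVU' m) gVB).

Lemma energy_outageE (m : 'I_M) :
  energy_outage s gVU m =
  gain_cdf s (VU m) (PC s / ((m.+1%:R - etaR s) * etaC s * PV s)).
Proof.
rewrite /energy_outage; under eq_set do rewrite energyE.
by rewrite (probability_gain_lt (gVU_density m)).
Qed.

Lemma decodingE (m : 'I_M) :
  P [set w | threshold s m <= snr_tag s m (gVU m w) (gVU' m w) /\
             thresholdU s <= snr_bs s (gVB w)] =
  ((1 - gain_cdf s VB (thresholdU s * noiseB s / PV s)) *
   (1 - \int[lebesgue_measure]_(x in `]0, +oo[)
     (gain_cdf s (VU m) (tag_cutoff m x) * gain_pdf s (VU m) x)))%:E.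
Proof.
have gVU'_density : has_density (gVU' m) (gain_pdf s (VU m)).
  by move=> A mA; rewrite gVU'_distr// gVU_density.
pose C : set R := `[thresholdU s * noiseB s / PV s, +oo[%classic.
rewrite (_ : mkset _ =
    [set w | [set p | threshold s m <= snr_tag s m p.1 p.2]
             (gVU m w, gVU' m w)] `&` gVB @^-1` C); last first.
  by apply/seteqP; split=> w /=; rewrite /C/= in_itv/= andbT snr_bsE.
have mA := measurable_snr_tag m.
rewrite (independent3_density (gVU_indep m) (gVU_density m))//; last 2 first.
- exact: measurable_gain_pdf.
- exact: measurable_itv.
rewrite EFinM; congr (_ * _)%E.
  rewrite -(probability_gain_ge gVB_density); congr (P _).
  by apply/seteqP; split=> w; rewrite /C/= in_itv/= andbT.
(* Given the first gain [x], decoding fails when the second gain is below [tag_cutoff m x], so [G x]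
   is the distribution function there. *)
apply: (integral_gain_pdf_compl (gVU_density m)).
- move=> x x0; rewrite -(probability_gain_ge gVU'_density).
  by under eq_set do rewrite /= snr_tagE//.
- exact: measurable_section_probability.
- by move=> x; exact: gain_cdf_bound (gVU_density m).
Qed.

End outage.

(** * Closed form of the average outage *)

Theorem theorem1 (R : realType) (d : measure_display) (T : measurableType d)
  (P : probability T R) (M : nat) (M_ge1 : (1 <= M)%N) (s : system R M)
  (gVU gVU' : 'I_M -> {RV P >-> R}) (gVB : {RV P >-> R})
  (gVU_density : forall m, has_density (gVU m) (gain_pdf s (VU m)))
  (gVB_density : has_density gVB (gain_pdf s VB))
  (gVU'_distr : forall m, same_distribution (gVU' m) (gVU m))
  (gVU_indep : forall m, independent3 (gVU m) (gVU' m) gVB) :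
  let A : R :=
    1 - prob s VB LoS *
          lower_Gamma (shape_factor s VB LoS)
            (thresholdU s * noiseB s * dist s VB ^+ 2 * shape_factor s VB LoS
             / (PV s * beta0 s))
      - prob s VB NLoS *
          lower_Gamma (shape_factor s VB NLoS)
            (thresholdU s * noiseB s * dist s VB ^+ 2 * shape_factor s VB NLoS
             / (PV s * eta_nlos s VB * beta0 s)) in
  let B (m : 'I_M) : R :=
    1 - prob s (VU m) LoS *
          lower_Gamma (shape_factor s (VU m) LoS)
            (PC s * dist s (VU m) ^+ 2 * shape_factor s (VU m) LoS
             / ((m.+1%:R - etaR s) * etaC s * PV s * beta0 s))
      - prob s (VU m) NLoS *
          lower_Gamma (shape_factor s (VU m) NLoS)
            (PC s * dist s (VU m) ^+ 2 * shape_factor s (VU m) NLoS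
             / ((m.+1%:R - etaR s) * etaC s * PV s * beta0 s * eta_nlos s (VU m))) in
  let C (m : 'I_M) : R :=
    1 - \int[lebesgue_measure]_(y in `]0, +oo[)
      ((prob s (VU m) LoS *
          lower_Gamma (shape_factor s (VU m) LoS)
            (threshold s m * (y * noiseU s m + noiseV s) * dist s (VU m) ^+ 2
             * shape_factor s (VU m) LoS / (etaR s * PV s * y * beta0 s))
        + prob s (VU m) NLoS *
          lower_Gamma (shape_factor s (VU m) NLoS)
            (threshold s m * (y * noiseU s m + noiseV s) * dist s (VU m) ^+ 2
             * shape_factor s (VU m) NLoS
             / (etaR s * PV s * y * eta_nlos s (VU m) * beta0 s)))
       * (prob s (VU m) LoS * link_pdf s (VU m) LoS y
          + prob s (VU m) NLoS * link_pdf s (VU m) NLoS y)) in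
  system_outage s gVU gVU' gVB = 1 - M%:R^-1 * \sum_(m < M) A * B m * C m.
Proof.
move=> A B C.
have M0 : M%:R != 0 :> R by rewrite pnatr_eq0 -lt0n.
(* Since 0^-1 = 0, [invfM] splits inverses without side conditions, and [ring] alone matches the
   arguments here and below. *)
have AE : 1 - gain_cdf s VB (thresholdU s * noiseB s / PV s) = A.
  by rewrite gain_cdf_LoS_NLoS opprD addrA /A; congr (_ - _ * _ - _ * _);
    congr lower_Gamma; rewrite !invfM; ring.
have BE m : 1 - gain_cdf s (VU m)
    (PC s / ((m.+1%:R - etaR s) * etaC s * PV s)) = B m.
  by rewrite gain_cdf_LoS_NLoS opprD addrA /B; congr (_ - _ * _ - _ * _);
    congr lower_Gamma; rewrite !invfM; ring.
have CE m : 1 - \int[lebesgue_measure]_(x in `]0, +oo[)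
    (gain_cdf s (VU m) (tag_cutoff s m x) * gain_pdf s (VU m) x) = C m.
  rewrite /C; congr (1 - _); apply: eq_Rintegral => x _.
  rewrite gain_cdf_LoS_NLoS /tag_cutoff; congr ((_ * _ + _ * _) * _);
    congr lower_Gamma; rewrite !invfM; ring.
rewrite /system_outage.
(* With decoding probability D = A C_m and energy outage E = 1 - B_m, (1 - D)(1 - E) + E = 1 - D(1 -
   E). *)
transitivity (M%:R^-1 * \sum_(m < M) (1 - A * B m * C m)).
  congr (_ * _); apply: eq_bigr => m _; rewrite /tag_outage.
  rewrite (decodingE gVU_density gVB_density gVU'_distr gVU_indep).
  rewrite (energy_outageE gVU_density) [fine _]/= AE CE -BE; ring.
(* The constant terms average to 1 because M >= 1. *)
by rewrite sumrB sumr_const card_ord mulrBr mulVf.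
Qed.
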